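(* Let $\mathcal{H}$ be a subgroup of $F_n\times\mathbb{A}$, where $F_n$ is a free group of finite rank $n$ and $\mathbb{A}$ is a finitely generated abelian group. Let $\{v_i\}_{i\in I}$ be a right transversal for $\mathcal{H}\pi$ in $F_n$, and let $\{\mathbf c_j\}_{j\in J}$ be a transversal for $L_{\mathcal{H}}=\mathcal{H}\cap\mathbb{A}$ in $\mathbb{A}$. Then $\{v_i\,t^{\mathbf c_j}\mid i\in I,\ j\in J\}$ is a right transversal for $\mathcal{H}$ in $F_n\times\mathbb{A}$. Hence $$[F_n\times\mathbb{A}:\mathcal{H}]=[F_n:\mathcal{H}\pi]\cdot[\mathbb{A}:L_{\mathcal{H}}];$$ in particular, the index $[F_n\times\mathbb{A}:\mathcal{H}]$ is finite if and only if both $[F_n:\mathcal{H}\pi]$ and $[\mathbb{A}:L_{\mathcal{H}}]$ are finite.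
   Context: Elements of $F_n\times\mathbb{A}$ are written $w\,t^{\mathbf a}$ ($w\in F_n$, $\mathbf a\in\mathbb{A}$, $\mathbb{A}$ additive), and $\pi\colon F_n\times\mathbb{A}\to F_n$, $w\,t^{\mathbf a}\mapsto w$, is the projection to the free part; $\mathbb{A}$ is identified with the subgroup $\{t^{\mathbf a}\}$. A right transversal is a (non-redundantly indexed) set of representatives of the right cosets $Hg$. *)

(* Defs.v *)
From HB Require Import structures.
From mathcomp Require Import all_boot all_algebra.
From mathcomp Require Import all_classical.

Set Implicit Arguments.
Unset Strict Implicit.
Unset Printing Implicit Defensive.

Local Open Scope classical_set_scope.
Local Open Scope group_scope.

(* Universal property of a basis x_0, ..., x_(n-1) of F. A multiplicative map *)
(* between groups is a group homomorphism.                                    *)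
Definition free_basis (n : nat) (F : groupType) (x : 'I_n -> F) : Prop :=
  forall (G : groupType) (y : 'I_n -> G),
    exists2 f : {multiplicative F -> G},
      forall i, f (x i) = y i &
      forall g : {multiplicative F -> G}, (forall i, g (x i) = y i) -> g =1 f.

Definition free_of_rank (n : nat) (F : groupType) : Prop :=
  exists x : 'I_n -> F, free_basis x.

Definition finitely_generated (A : zmodType) : Prop :=
  exists (m : nat) (s : m.-tuple A), forall a : A, inIntSpan s a.

Section Cosets.
Variable G : groupType.
Implicit Types (H : set G) (g : G).

Definition subgroup H : Prop := group_closed (mem H).

Definition right_coset H g : set G := [set h * g | h in H].

Definition right_cosets H : set (set G) := range (right_coset H).

(* i |-> H v_i is a bijection from I onto the set of right cosets of H. In    *)
(* particular the family v is injective.                                      *)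
Definition right_transversal H (I : Type) (v : I -> G) : Prop :=
  set_bij [set: I] (right_cosets H) (fun i => right_coset H (v i)).

Definition finite_index H : Prop := finite_set (right_cosets H).

End Cosets.

Section FreeTimesAbelian.
Variables (F : groupType) (A : zmodType).

(* to_multiplicative A is A with its addition as the group law, so that the   *)
(* element w t^a of F x A is the pair (w, a), with                            *)
(* (w, a) * (u, b) = (w * u, a + b).                                          *)
Definition free_part (H : set (F * Algebra.to_multiplicative A)) : set F :=
  fst @` H.

(* The intersection of H with A, where a is identified with t^a = (1, a).     *)
Definition abelian_part (H : set (F * Algebra.to_multiplicative A)) :
    set (Algebra.to_multiplicative A) :=
  [set a | H (1, a)].

End FreeTimesAbelian.

(* Main.v *)
Require Import Defs.
From HB Require Import structures.
From mathcomp Require Import all_boot all_algebra.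
From mathcomp Require Import all_classical.

(** Two elements lie in the same right coset of H exactly when their quotient
    lies in H, so a transversal is a family v such that every g has a quotient
    [g * (v i)^-1] in H, and [v i * (v j)^-1] is in H only for [i = j].

    The quotients of pairs are computed componentwise.  Given (w, a), choose i
    with [w * (v i)^-1] in the projection of H, lift this quotient to an element
    (w * (v i)^-1, b) of H, and choose j such that [b^-1 * a * (c j)^-1] lies in
    the intersection of H with the abelian factor: the product of these two
    elements of H is the quotient of (w, a) by (v i, c j).  Conversely, if two
    pairs have their quotient in H, its projection forces the first indices to
    agree; then the quotient has trivial first component, so it lies in the
    intersection and the second indices agree too.

    The index formula follows by applying this to transversals indexed by the
    sets of cosets themselves.  As neither factor is empty, their product is
    finite only if both are. *)

Set Implicit Arguments.
Unset Strict Implicit.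
Unset Printing Implicit Defensive.

Local Open Scope classical_set_scope.
Local Open Scope card_scope.
Local Open Scope group_scope.

Section SubgroupCosets.
Variables (G : groupType) (H : set G).
Hypothesis hH : subgroup H.

Lemma subgroup1 : H 1.
Proof. by case: hH => /set_mem. Qed.

Lemma subgroupM x y : H x -> H y -> H (x * y).
Proof.
by move=> Hx Hy; apply: set_mem; apply: (group_closedM hH); exact: mem_set.
Qed.

Lemma subgroupV x : H x -> H x^-1.
Proof.
by move=> Hx; apply: set_mem; apply: (group_closedV hH); exact: mem_set.
Qed.

Lemma right_coset_eqP g g' :
  right_coset H g = right_coset H g' <-> H (g * g'^-1).
Proof.
split=> [eqC|Hq].
  have : right_coset H g g by exists 1; [exact: subgroup1 | rewrite mul1g].
  by rewrite eqC => -[h Hh <-]; rewrite mulgK.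
apply/seteqP; split=> _ [h Hh <-].
  by exists (h * (g * g'^-1)); [exact: subgroupM | rewrite mulgA mulgVK].
exists (h * (g * g'^-1)^-1); first by apply/subgroupM/subgroupV.
by rewrite invgM invgK mulgA mulgVK.
Qed.

(** Replaces equality of cosets, as sets, by membership of quotients in H, which
    for pairs can be analysed one component at a time. *)
Lemma right_transversalP (I : Type) (v : I -> G) :
  right_transversal H v <->
  (forall g, exists i, H (g * (v i)^-1)) /\
  (forall i j, H (v i * (v j)^-1) -> i = j).
Proof.
split=> [[_ v_inj v_surj]|[v_onto v_inj]].
  split=> [g|i j /right_coset_eqP].
    have [i _ eqC] := v_surj (right_coset H g) (ex_intro2 _ _ g Logic.I erefl).
    by exists i; apply/right_coset_eqP.
  by apply: v_inj; rewrite inE.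
split=> [i _|i j _ _ /right_coset_eqP|_ [g _ <-]].
- by exists (v i).
- exact: v_inj.
- by have [i /right_coset_eqP ->] := v_onto g; exists i.
Qed.

(** The coset itself serves as the index of its representative, so that the
    index type has the cardinality of the set of cosets by construction. *)
Lemma exists_right_transversal :
  exists v : right_cosets H -> G, right_transversal H v.
Proof.
have repr (C : right_cosets H) : exists g, right_coset H g = val C.
  by have [g _ eqC] := set_valP C; exists g.
have [v vP] := choice repr; exists v; split=> [C _|C D _ _|_ [g _ <-]].
- by exists (v C).
- by rewrite /= !vP => /val_inj.
- have Cg : right_cosets H (right_coset H g) by exists g.
  by exists (SigSub (mem_set Cg)) => //=; rewrite vP.
Qed.

Lemma right_transversal_card (I : Type) (v : I -> G) :
  right_transversal H v -> right_cosets H #= [set: I].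
Proof.
move=> [v_hom v_inj v_surj].
rewrite (_ : right_cosets H = range (fun i => right_coset H (v i))).
  exact: inj_card_eq.
by apply/seteqP; split=> [C /v_surj //|_ [i _ <-]]; exact: v_hom.
Qed.

End SubgroupCosets.

Lemma right_cosets_neq0 (G : groupType) (H : set G) : right_cosets H !=set0.
Proof. by exists (right_coset H 1); exists 1. Qed.

(** Turns a product index type into the product of two sets of cosets. *)
Lemma card_setX_set_type (T U : Type) (A : set T) (B : set U) :
  [set: A * B] #= A `*` B.
Proof.
rewrite (_ : A `*` B = range (fun p : A * B => (val p.1, val p.2))).
  apply: card_esym; apply: inj_card_eq => -[a b] [a' b'] _ _ /=.
  by case=> /val_inj -> /val_inj ->.
apply/seteqP; split=> [[a b] [/= Aa Bb]|_ [[a b] _ <-]].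
  by exists (SigSub (mem_set Aa), SigSub (mem_set Bb)).
by split; exact: set_valP.
Qed.

Lemma finite_setX_iff (T U : Type) (A : set T) (B : set U) :
  A !=set0 -> B !=set0 ->
  finite_set (A `*` B) <-> finite_set A /\ finite_set B.
Proof.
move=> [a Aa] [b Bb]; split=> [fAB|[fA fB]]; last exact: finite_setX.
split.
  rewrite (_ : A = fst @` (A `*` B)); first exact: finite_image.
  by apply/seteqP; split=> [x Ax|_ [[x y] [/= Ax _] <-]//]; exists (x, b).
rewrite (_ : B = snd @` (A `*` B)); first exact: finite_image.
by apply/seteqP; split=> [y By|_ [[x y] [/= _ By] <-]//]; exists (a, y).
Qed.

Section FreeTimesAbelianTransversal.
Variables (F : groupType) (A : zmodType).
Local Notation mA := (Algebra.to_multiplicative A).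
Variable H : set (F * mA).
Hypothesis hH : subgroup H.

Lemma subgroup_free_part : subgroup (free_part H).
Proof.
split=> [|_ _ /set_mem [x Hx <-] /set_mem [y Hy <-]]; apply: mem_set.
  by exists 1; first exact: subgroup1.
by exists (x * y^-1); first exact: (subgroupM hH Hx (subgroupV hH Hy)).
Qed.

Lemma subgroup_abelian_part : subgroup (abelian_part H).
Proof.
split=> [|a b /set_mem Ha /set_mem Hb]; apply: mem_set.
  exact: (subgroup1 hH).
(* (1, a * b^-1) is the quotient of (1, a) by (1, b) once 1 is 1 * 1^-1. *)
rewrite /abelian_part /= -[X in (X, _)](mulgV 1).
exact: (subgroupM hH Ha (subgroupV hH Hb)).
Qed.

(** The coset of w modulo the projection fixes i but leaves the lift b of the
    quotient free; changing the lift moves b by an element of the intersection,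
    so exactly one j is compatible with it. *)
Lemma right_transversal_pair (I J : Type) (v : I -> F) (c : J -> mA) :
  right_transversal (free_part H) v ->
  right_transversal (abelian_part H) c ->
  right_transversal H (fun p : I * J => (v p.1, c p.2)).
Proof.
move=> /(right_transversalP subgroup_free_part) [v_onto v_inj].
move=> /(right_transversalP subgroup_abelian_part) [c_onto c_inj].
apply/(right_transversalP hH); split=> [[w a]|[i j] [i' j'] /= Hq].
  have [i [[u b] Hb /= def_u]] := v_onto w; subst u.
  (* The lift already uses up b of the second component: j represents the rest. *)
  have [j Hj] := c_onto (b^-1 * a); exists (i, j) => /=.
  have -> : (w, a) * (v i, c j)^-1 =
            (w * (v i)^-1, b) * (1, b^-1 * a * (c j)^-1).
    by apply: (congr2 pair); rewrite ?mulg1 // !mulgA mulgV mul1g.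
  exact: (subgroupM hH Hb Hj).
have eq_i : i = i' by apply: v_inj; exists ((v i, c j) * (v i', c j')^-1).
subst i'; congr pair; apply: c_inj.
(* Writing 1 as v i * (v i)^-1 turns the goal into the quotient of the pairs. *)
by rewrite /abelian_part /= -[X in (X, _)](mulgV (v i)).
Qed.

Lemma card_right_cosets :
  right_cosets H #= right_cosets (free_part H) `*` right_cosets (abelian_part H).
Proof.
have [v vT] := exists_right_transversal (free_part H).
have [c cT] := exists_right_transversal (abelian_part H).
apply: card_eq_trans (card_setX_set_type _ _).
exact: right_transversal_card (right_transversal_pair vT cT).
Qed.

End FreeTimesAbelianTransversal.

Local Close Scope group_scope.

Theorem proposition5p1 (n : nat) (F : groupType) (A : zmodType)
    (hF : free_of_rank n F) (hA : finitely_generated A)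
    (H : set (F * Algebra.to_multiplicative A)) (hH : subgroup H) :
  [/\ forall (I J : Type) (v : I -> F) (c : J -> Algebra.to_multiplicative A),
        right_transversal (free_part H) v ->
        right_transversal (abelian_part H) c ->
        right_transversal H (fun p : I * J => (v p.1, c p.2)),
      right_cosets H #=
        right_cosets (free_part H) `*` right_cosets (abelian_part H) &
      finite_index H <->
        finite_index (free_part H) /\ finite_index (abelian_part H)].
Proof.
split.
- by move=> I J v c; exact: right_transversal_pair.
- exact: card_right_cosets.
- rewrite /finite_index (eq_finite_set (card_right_cosets hH)).
  by apply: finite_setX_iff; exact: right_cosets_neq0.
Qed.
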